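(* Let $t\in\mathbb{N}$, $c\in\mathbb{R}_{>0}$, and let $H=(V,\mathcal{E})$ be a finite hypergraph with the Hereditary Linear Delaunay property with parameter $c$. Then $\chi^t_{CF}(H)=O(c\,t^2\log|V|)$, where the implied constant is absolute (independent of $H$, $c$ and $t$). Moreover, there are hypergraphs with the Hereditary Linear Delaunay property (for some parameter $c$) and arbitrarily many vertices for which $\chi^t_{CF}(H)=\Omega(\log|V|)$.
   Context: A hypergraph $H=(V,\mathcal{E})$ consists of a finite vertex set $V$ and a family $\mathcal{E}\subseteq 2^V$ of hyperedges. For $V'\subseteq V$, the induced sub-hypergraph is $H[V']=(V',\{h\cap V' : h\in\mathcal{E}\})$. The Delaunay graph of $H$ is the graph $\mathrm{Del}(H)=(V,\{h\in\mathcal{E}: |h|=2\})$. $H$ has the Hereditary Linear Delaunay (HLD) property with parameter $c\in\mathbb{R}_{>0}$ if for every $V'\subseteq V$ the graph $\mathrm{Del}(H[V'])$ has at most $c|V'|$ edges. For $t\in\mathbb{N}$, a $t$-subset-CF-colouring of $H$ with $k$ colours is a function $\varphi$ from the set $\binom{V}{t}$ of $t$-element subsets of $V$ to a $k$-element set such that for every $h\in\mathcal{E}$ with $|h|>t$ there is $s\in\binom{h}{t}$ with $\varphi(s)\neq\varphi(s')$ for all $s'\in\binom{h}{t}\setminus\{s\}$. $\chi^t_{CF}(H)$ is the least $k$ such that $H$ admits a $t$-subset-CF-colouring with $k$ colours.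
   Formalization: The upper bound is stated as max(1, C c t² log|V|), since the literal bound fails in degenerate cases (e.g. |V|=1, t=0, or no hyperedges with tiny c), where one colour suffices; the lower bound is stated for t ≥ 1, since one colour always suffices for t=0. *)

(* Defs.v *)
From HB Require Import structures.
From mathcomp Require Import all_boot all_order all_algebra.
From mathcomp Require Import boolp reals exp.
Set Implicit Arguments.
Unset Strict Implicit.
Unset Printing Implicit Defensive.
Import Order.TTheory GRing.Theory Num.Theory.
Local Open Scope nat_scope.

(* The vertex set is a subset of an ambient finite type, so that induced
   sub-hypergraphs live in the same type. *)
Record hypergraph (T : finType) := Hypergraph {
  vert : {set T};
  edges : {set {set T}};
  edges_vert : edges \subset powerset vert }.

Section Hypergraph.
Variable T : finType.
Implicit Types (H : hypergraph T) (A W h s : {set T}) (t k : nat).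

Lemma induced_subproof H W :
  [set h :&: W | h in edges H] \subset powerset W.
Proof. by apply/subsetP => _ /imsetP[h _ ->]; rewrite powersetE subsetIr. Qed.

Definition induced H W : hypergraph T := Hypergraph (induced_subproof H W).

Lemma delaunay_subproof H :
  [set h in edges H | #|h| == 2] \subset powerset (vert H).
Proof.
apply: subset_trans (edges_vert H).
by apply/subsetP => h; rewrite inE => /andP[].
Qed.

(* A graph is represented as a hypergraph all of whose edges have size 2. *)
Definition delaunay H : hypergraph T := Hypergraph (delaunay_subproof H).

Definition HLD (R : realType) (c : R) H : Prop :=
  forall W, W \subset vert H ->
    (#|edges (delaunay (induced H W))|%:R <= c * #|W|%:R)%R.

Definition tsubsets A t : {set {set T}} :=
  [set s : {set T} | s \subset A & #|s| == t].

(* Only the values of phi on [tsubsets (vert H) t] matter; the colour set is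
   {0, ..., k-1}. *)
Definition subset_CF_colouring H t k (phi : {set T} -> nat) : Prop :=
  (forall s, s \in tsubsets (vert H) t -> phi s < k) /\
  (forall h, h \in edges H -> t < #|h| ->
     exists2 s, s \in tsubsets h t &
       forall s', s' \in tsubsets h t :\ s -> phi s <> phi s').

Definition subset_CF_colourable H t k : Prop :=
  exists phi, subset_CF_colouring H t k phi.

Lemma subset_CF_colourable_ex H t :
  exists k, `[< subset_CF_colourable H t k >].
Proof.
exists #|{set T}|; apply/asboolP.
exists (fun s => nat_of_ord (enum_rank s)); split=> [s _|h _ lt_th]; first exact: ltn_ord.
have : 0 < #|tsubsets h t| by rewrite cards_draws bin_gt0 ltnW.
case/card_gt0P=> s sh; exists s => // s' /setD1P[/eqP ns _] e.
by apply: ns; apply: enum_rank_inj; apply: val_inj.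
Qed.

Definition chi_CF t H : nat := ex_minn (subset_CF_colourable_ex H t).

End Hypergraph.

(* Main.v *)
(* Upper bound. It suffices to find, for every W contained in V, a set I of at
   least |W|/O(ct) vertices of W such that each hyperedge of H[W] with more than
   t vertices keeps at least t of them outside I: removing such sets round after
   round exhausts V in O(c t log|V|) rounds, and colouring a t-subset by the
   first round that hits it is conflict-free.
   To get I, sample W with density p ~ 1/(ct) and delete a vertex from each
   sampled (m+1)-set lying in a hyperedge of size at most t+m. By the
   Clarkson-Shor technique, the pairs lying in hyperedges of size at most k form
   a graph with O(ck|U|) edges on every vertex set U. So this graph is
   O(ck)-degenerate, the (m+1)-sets in question are among its (m+1)-cliques, and
   there are at most |W| O(ct)^m of them.

   Lower bound. For the hypergraph of intervals of a path, delete a vertex of the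
   uniquely coloured t-subset: the longer of the two remaining intervals uses one
   colour fewer. *)
Require Import Defs.
From HB Require Import structures.
From mathcomp Require Import all_boot all_order all_algebra.
From mathcomp Require Import boolp reals exp.
From mathcomp Require Import sequences.
From mathcomp Require Import zify ring lra.
Import Order.TTheory GRing.Theory Num.Theory.
Local Open Scope ring_scope.
Set Implicit Arguments.
Unset Strict Implicit.

(** * Random subsets with independently chosen points *)

Section RandomSubset.
Variables (R : realFieldType) (T : finType) (p : R).

(** The probability of [S] when each point is kept independently with probability [p]. *)
Definition sampling (S : {set T}) : R :=
  \prod_(i : T) (if i \in S then p else 1 - p).

(** In each factor [p + (1 - p)], replace by 0 the choice forbidden by [A] or [B]; expanding the
    product leaves exactly the terms of the admissible [S]. *)
Lemma sampling_cylinder (A B : {set T}) : [disjoint A & B] ->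
  \sum_(S : {set T} | (A \subset S) && [disjoint B & S]) sampling S
    = p ^+ #|A| * (1 - p) ^+ #|B|.
Proof.
move=> dAB.
transitivity (\prod_(i : T) ((if i \in B then 0 else p) +
                             (if i \in A then 0 else 1 - p))).
  rewrite bigA_distr big_mkcond; apply: eq_bigr => S _.
  case: ifP => [/andP[AS BS]|/negbT].
    apply: eq_bigr => i _; case: ifPn => iS.
      by rewrite ifF //; apply/negbTE; apply: contraTN iS => /(disjointFr BS) ->.
    by rewrite ifF //; apply/negbTE; apply: contraNN iS; apply: subsetP.
  rewrite negb_and => /orP[/subsetPn[i iA iS]|].
    by rewrite (bigD1 i) //= (negbTE iS) iA mul0r.
  rewrite -setI_eq0 => /set0Pn[i /setIP[iB iS]].
  by rewrite (bigD1 i) //= iS iB mul0r.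
rewrite (bigID (mem A)) /= (eq_bigr (fun=> p)) => [|i iA]; last first.
  by rewrite iA (disjointFr dAB iA) addr0.
rewrite prodr_const; congr (_ * _).
rewrite (bigID (mem B)) /= [X in _ * X]big1 ?mulr1 => [|i]; last first.
  by case/andP=> /negbTE-> /negbTE->; rewrite addrC subrK.
rewrite (eq_bigl (fun i => i \in B)) => [|i]; last first.
    by case: (boolP (i \in B)) => iB; rewrite ?andbF // (disjointFl dAB iB).
rewrite -prodr_const; apply: eq_bigr => i iB.
by rewrite iB (disjointFl dAB iB) add0r.
Qed.

Lemma sampling_supset (A : {set T}) :
  \sum_(S : {set T} | A \subset S) sampling S = p ^+ #|A|.
Proof.
have := @sampling_cylinder A set0; rewrite cards0 expr0 mulr1 => <-.
  by apply: eq_bigl => S; rewrite -setI_eq0 set0I eqxx andbT.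
by rewrite -setI_eq0 setI0.
Qed.

Lemma sampling_sum1 : \sum_(S : {set T}) sampling S = 1.
Proof.
have := sampling_supset set0; rewrite cards0 expr0 => <-.
by apply: eq_bigl => S; rewrite sub0set.
Qed.

Lemma expected_count (F : {set {set T}}) :
  \sum_(S : {set T}) sampling S * #|[set b in F | b \subset S]|%:R
    = \sum_(b in F) p ^+ #|b|.
Proof.
rewrite (eq_bigr (fun S : {set T} => \sum_(b in F | b \subset S) sampling S)) => [|S _].
  rewrite (exchange_big_dep (mem F)) //=; last by move=> S b _ /andP[].
  apply: eq_bigr => b bF; rewrite -sampling_supset.
  by apply: eq_bigl => S; rewrite bF.
rewrite sumr_const mulr_natr; congr (_ *+ _).
by apply: eq_card => b; rewrite inE.
Qed.

Lemma expected_card (W : {set T}) :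
  \sum_(S : {set T}) sampling S * #|S :&: W|%:R = p * #|W|%:R.
Proof.
rewrite (eq_bigr (fun S : {set T} => \sum_(i in W | i \in S) sampling S)) => [|S _].
  rewrite (exchange_big_dep (mem W)) //=; last by move=> S i _ /andP[].
  rewrite (eq_bigr (fun=> p)) => [|i iW]; first by rewrite sumr_const mulr_natr.
  rewrite -[RHS]expr1 -(cards1 i) -sampling_supset.
  by apply: eq_bigl => S; rewrite sub1set iW.
rewrite sumr_const mulr_natr; congr (_ *+ _).
by apply: eq_card => i; rewrite !inE andbC.
Qed.

Hypotheses (p_ge0 : 0 <= p) (p_le1 : p <= 1).

Lemma sampling_ge0 S : 0 <= sampling S.
Proof. by apply: prodr_ge0 => i _; case: ifP => _ //; rewrite subr_ge0. Qed.

Lemma expectation_attained (f : {set T} -> R) :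
  exists S, \sum_(S' : {set T}) sampling S' * f S' <= f S.
Proof.
case: (arg_maxP f (erefl : predT set0)) => S _ fS; exists S.
rewrite -[leRHS]mul1r -sampling_sum1 mulr_suml; apply: ler_sum => S' _.
by apply: ler_wpM2l; [apply: sampling_ge0 | apply: fS].
Qed.

End RandomSubset.

(** * Counting shallow subsets *)

Section ShallowSubsets.
Variables (R : realType) (T : finType) (c : R) (H : hypergraph T).
Hypothesis hldH : HLD c H.
Implicit Types (W b h : {set T}) (j k m : nat).

(** Depth is measured on the trace [h :&: W], so a shallow set avoiding a vertex stays shallow when
    that vertex leaves [W]; induction on [W] relies on this. *)
Definition shallow_subsets j k W : {set {set T}} :=
  [set b in powerset W | (#|b| == j) &&
     [exists h in edges H, (b \subset h) && (#|h :&: W| <= k)%N]].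

Lemma shallow_subsetsP {j k W b} :
  reflect [/\ b \subset W, #|b| = j &
             exists2 h, h \in edges H & b \subset h /\ (#|h :&: W| <= k)%N]
          (b \in shallow_subsets j k W).
Proof.
rewrite inE powersetE; apply: (iffP and3P) => [[bW /eqP bj]|[bW bj [h hH [bh hk]]]].
  by case/exists_inP=> h hH /andP[bh hk]; split => //; exists h.
by split; [| apply/eqP | apply/exists_inP; exists h => //; rewrite bh].
Qed.

Lemma HLD_card W : W \subset vert H ->
  #|[set b in [set h :&: W | h in edges H] | #|b| == 2]|%:R <= c * #|W|%:R.
Proof. exact: hldH. Qed.

(* Clarkson-Shor: a shallow pair becomes a Delaunay edge of the hypergraph
   induced on a random sample of density 1/(2k) with probability at least
   1/(8k^2), by Bernoulli's inequality. *)
Lemma card_shallow_pairs k W : (0 < k)%N -> W \subset vert H ->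
  #|shallow_subsets 2 k W|%:R <= 4 * c * k%:R * #|W|%:R.
Proof.
move=> k_gt0 WV; set F := shallow_subsets 2 k W.
have k_gt0R : 0 < k%:R :> R by rewrite ltr0n.
have k_ge1R : 1 <= k%:R :> R by rewrite ler1n.
(* With [p * k = 1/2], Bernoulli's inequality gives probability at least 1/2 of missing up to [k]
   given points. *)
pose p : R := (2 * k%:R)^-1.
have pE : p * k%:R = 1 / 2 by rewrite /p; field; rewrite pnatr_eq0 -lt0n.
have p_gt0 : 0 < p by rewrite invr_gt0 mulr_gt0.
have p_le1 : p <= 1 by nra.
have bernoulli n : 1 - p * n%:R <= (1 - p) ^+ n.
  elim: n => [|n IH]; first by rewrite mulr0 subr0 expr0.
  rewrite exprS -[n.+1]addn1 natrD; have : 0 <= n%:R :> R by []; nra.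
have lower : #|F|%:R * (p ^+ 2 / 2)
    <= \sum_(S : {set T}) sampling p S * (c * #|S :&: W|%:R).
  pose D (S : {set T}) :=
    [set b in [set h :&: (S :&: W) | h in edges H] | #|b| == 2].
  apply: (@le_trans _ _ (\sum_(S : {set T}) sampling p S * #|F :&: D S|%:R)).
    rewrite (eq_bigr (fun S : {set T} => \sum_(b in F | b \in D S) sampling p S)); last first.
      move=> S _; rewrite sumr_const mulr_natr; congr (_ *+ _).
      by apply: eq_card => b; rewrite inE.
    rewrite (exchange_big_dep (mem F)) //=; last by move=> S b _ /andP[].
    rewrite mulr_natl -sumr_const; apply: ler_sum => b bF.
    have /shallow_subsetsP[bW b2 [h hH [bh hk]]] := bF.
    (* [b] is the trace of [h] on the sample within [W] once the sample contains [b] and misses the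
       rest of [h :&: W]. *)
    have dis : [disjoint b & (h :&: W) :\: b].
      by rewrite -setI_eq0 setIDA setDIl setDv set0I.
    have := sampling_cylinder p dis; rewrite b2 => cyl.
    apply: (@le_trans _ _ (p ^+ 2 * (1 - p) ^+ #|(h :&: W) :\: b|)).
      rewrite ler_wpM2l ?sqr_ge0 //; apply: le_trans (bernoulli _).
      have : #|(h :&: W) :\: b|%:R <= k%:R :> R.
        by rewrite ler_nat (leq_trans _ hk) // subset_leq_card // subsetDl.
      nra.
    rewrite -cyl [leLHS]big_mkcond [leRHS]big_mkcond; apply: ler_sum => S _.
    case: ifP => [/andP[bS dS]|_]; last first.
      by case: ifP => // _; apply: sampling_ge0 => //; apply: ltW.
    rewrite ifT // bF !inE b2 eqxx andbT /=; apply/imsetP; exists h => //.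
    apply/eqP; rewrite eqEsubset !subsetI bh bS bW /=.
    apply/subsetP => x /setIP[xh /setIP[xS xW]].
    by apply: contraTT xS => xb; rewrite (disjointFr dS) // !inE xb xh.
  apply: ler_sum => S _; apply: ler_wpM2l; first by apply: sampling_ge0 => //; apply: ltW.
  apply: (@le_trans _ _ #|D S|%:R); first by rewrite ler_nat subset_leq_card // subsetIr.
  by apply: HLD_card; apply: subset_trans WV; apply: subsetIr.
move: lower; under eq_bigr do rewrite mulrCA.
rewrite -mulr_sumr expected_card [c * _]mulrA => lower.
have -> : 4 * c * k%:R * #|W|%:R = (c * p * #|W|%:R) / (p ^+ 2 / 2).
  by rewrite /p; field; rewrite pnatr_eq0 -lt0n.
by rewrite ler_pdivlMr // divr_gt0 // exprn_gt0.
Qed.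

Lemma shallow_subset_trans j k W (b b' : {set T}) :
  b \in shallow_subsets j k W -> b' \subset b ->
  b' \in shallow_subsets #|b'| k W.
Proof.
case/shallow_subsetsP=> bW _ [h hH [bh hk]] b'b; apply/shallow_subsetsP.
by split=> //; [apply: subset_trans bW | exists h => //; split=> //; apply: subset_trans bh].
Qed.

(* Shallow pairs form a graph in which every induced subgraph has a vertex of
   degree at most 8ck, and shallow sets are cliques of this graph. *)
Lemma card_shallow_subsets m k W : (0 < k)%N -> W \subset vert H ->
  #|shallow_subsets m.+1 k W|%:R * m`!%:R <= #|W|%:R * (8 * c * k%:R) ^+ m.
Proof.
move=> k_gt0.
have [n] := ubnP #|W|; elim: n W => // n IH W /ltnSE Wn WV.
have [->|W_neq0] := eqVneq W set0.
  rewrite [shallow_subsets _ _ _](_ : _ = set0) ?cards0 ?mul0r //.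
  apply/setP => b; rewrite in_set0; apply/negP => /shallow_subsetsP[+ bm _].
  by rewrite subset0 => /eqP b0; rewrite b0 cards0 in bm.
set F2 := shallow_subsets 2 k W.
pose deg v := #|[set b in F2 | v \in b]|.
have [v vW vdeg] : exists2 v, v \in W & (deg v)%:R <= 8 * c * k%:R.
  apply: contrapT => no_v.
  (* If every degree exceeded [8ck], double counting incidences would give more than [4ck|W|]
     shallow pairs. *)
  have : #|W|%:R * (8 * c * k%:R) < \sum_(v in W) (deg v)%:R.
    rewrite mulr_natl -sumr_const; apply: ltr_sum => [|v vW].
      by case/set0Pn: W_neq0 => v vW; apply/hasP; exists v; rewrite ?mem_index_enum.
    by rewrite ltNge; apply/negP => v_low; apply: no_v; exists v.
  rewrite -natr_sum.
  have -> : (\sum_(v in W) deg v = 2 * #|F2|)%N.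
    rewrite (eq_bigr (fun v => \sum_(b in F2 | v \in b) 1)%N) => [|v _]; last first.
      by rewrite sum1_card; apply: eq_card => b; rewrite inE.
    rewrite (exchange_big_dep (mem F2)) //=; last by move=> v b _ /andP[].
    rewrite (eq_bigr (fun=> 2%N)) => [|b bF]; first by rewrite sum_nat_const mulnC.
    rewrite sum1_card; have /shallow_subsetsP[bW <- _] := bF.
    apply: eq_card => v; rewrite unfold_in bF /=.
    by case: (boolP (v \in b)) => [/(subsetP bW) ->|]; rewrite ?andbF.
  rewrite natrM => lt1.
  by have := card_shallow_pairs k_gt0 WV; rewrite -/F2; nra.
pose N := [set u in W :\ v | [set v; u] \in F2].
have N_deg : (#|N| <= deg v)%N.
  rewrite -(@card_in_imset _ _ (fun u => [set v; u]) N).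
    apply: subset_leq_card; apply/subsetP => _ /imsetP[u + ->].
    by rewrite inE => /andP[_ uvF]; rewrite inE uvF !inE eqxx.
  move=> u u'; rewrite inE => /andP[/setD1P[uv _] _] _ /setP/(_ u).
  by rewrite !inE eqxx orbT (negbTE uv) /= => /esym/eqP.
have W'W : W :\ v \subset W by apply: subsetDl.
have W'V := subset_trans W'W WV.
have W'E : #|W| = #|W :\ v|.+1 by rewrite (cardsD1 v W) vW.
have {}IH := IH (W :\ v) _ W'V; rewrite W'E in Wn; have {}IH := IH Wn.
(* A shallow set either avoids [v] or consists of [v] and [m] of its neighbours. *)
have cover : shallow_subsets m.+1 k W \subset
    shallow_subsets m.+1 k (W :\ v) :|: [set v |: b | b in tsubsets N m].
  apply/subsetP => b bF; have /shallow_subsetsP[bW bm [h hH [bh hk]]] := bF.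
  rewrite inE; case: (boolP (v \in b)) => vb; apply/orP; [right|left]; last first.
    apply/shallow_subsetsP; split=> //; first by rewrite subsetD1 bW vb.
    exists h => //; split=> //; apply: leq_trans hk.
    by apply: subset_leq_card; apply: setIS.
  apply/imsetP; exists (b :\ v); last by rewrite setD1K.
  rewrite inE; have := cardsD1 v b; rewrite vb bm add1n => -[->]; rewrite eqxx andbT.
  apply/subsetP => u /setD1P[uv ub]; rewrite inE in_setD1 uv (subsetP bW) //=.
  have -> : F2 = shallow_subsets #|[set v; u]| k W by rewrite cards2 eq_sym uv.
  by apply: (shallow_subset_trans bF); rewrite subUset !sub1set vb.
have cnt : (#|shallow_subsets m.+1 k W| <=
            #|shallow_subsets m.+1 k (W :\ v)| + 'C(#|N|, m))%N.
  apply: leq_trans (subset_leq_card cover) _.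
  apply: leq_trans (leq_card_setU _ _) _; rewrite leq_add2l -cards_draws.
  exact: leq_imset_card.
(* Nonnegativity comes from the degree of [v], a natural number. *)
have ck_ge0 : 0 <= 8 * c * k%:R by apply: le_trans vdeg.
have binN : 'C(#|N|, m)%:R * m`!%:R <= (8 * c * k%:R) ^+ m.
  rewrite -natrM bin_ffact; apply: (@le_trans _ _ (#|N|%:R ^+ m)).
    rewrite -natrX ler_nat; elim: (m) => [|i IHi]; first by rewrite ffactn0.
    by rewrite ffactnSr expnSr leq_mul // leq_subr.
  apply: lerXn2r; rewrite ?nnegrE ?ler0n //.
  by apply: le_trans vdeg; rewrite ler_nat.
rewrite W'E -[(#|_|.+1)%:R]natr1 mulrDl mul1r.
apply: le_trans (lerD IH binN); rewrite -mulrDl -natrD.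
by rewrite ler_wpM2r ?ler0n // ler_nat.
Qed.

End ShallowSubsets.

(** * Elementary estimates *)

Lemma leq_bin_exp2 n m : ('C(n, m) <= 2 ^ n)%N.
Proof.
elim: n m => [|n IH] [|m]; rewrite ?bin0 ?expn_gt0 //.
by rewrite binS expnS mul2n -addnn leq_add.
Qed.

(** Each of the first [m] factors of the falling factorial of [2m] is at least [m], and that
    factorial is ['C(2m, m) * m!]. *)
Lemma leq_expnn_fact m : (m ^ m <= 4 ^ m * m`!)%N.
Proof.
have ffact_lb j : (j <= m)%N -> (m ^ j <= (2 * m) ^_ j)%N.
  elim: j => [|j IH] jm; first by rewrite ffactn0.
  by rewrite ffactnSr expnSr leq_mul ?IH //; lia.
apply: leq_trans (ffact_lb m (leqnn m)) _.
by rewrite -bin_ffact leq_mul2r -[4%N]/(2 ^ 2)%N -expnM leq_bin_exp2 orbT.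
Qed.

Lemma leq_card_bigcup (I T : finType) (F : I -> {set T}) :
  (#|\bigcup_i F i| <= \sum_i #|F i|)%N.
Proof.
elim/big_ind2: _ => [|A m B n Am Bn|//]; first by rewrite cards0.
by apply: leq_trans (leq_card_setU _ _) _; apply: leq_add.
Qed.

Lemma exists_tsubset (T : finType) (A : {set T}) t :
  (t <= #|A|)%N -> exists s, s \in tsubsets A t.
Proof. by move=> tA; apply/card_gt0P; rewrite cards_draws bin_gt0. Qed.

Lemma sum_quarter_powers (R : realFieldType) n :
  \sum_(m < n) (1 / 4 : R) ^+ m.+1 <= 1 / 2.
Proof.
suff -> : \sum_(m < n) (1 / 4 : R) ^+ m.+1 = (1 - (1 / 4) ^+ n) / 3.
  have : 0 <= (1 / 4 : R) ^+ n by rewrite exprn_ge0 ?divr_ge0.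
  by lra.
elim: n => [|n IH]; first by rewrite big_ord0 expr0 subrr mul0r.
by rewrite big_ord_recr /= IH exprS; field.
Qed.

(** * Sparse sets and colouring in rounds *)

Section UpperBound.
Variables (R : realType) (T : finType) (c : R) (H : hypergraph T) (t : nat).
Hypotheses (hldH : HLD c H) (c_ge : 1 / 2 <= c) (t_gt0 : (0 < t)%N).
Implicit Types (W I h s : {set T}).

Let t_ge1 : 1 <= t%:R :> R. Proof. by rewrite ler1n. Qed.
(** The constant makes [64 * (c * t) * p] equal to 1/4, the ratio of the geometric series below. *)
Let p : R := (256 * c * t%:R)^-1.
Let c_gt0 : 0 < c. Proof. by have := c_ge; lra. Qed.
Let ct_ge : 1 / 2 <= c * t%:R.
Proof. by have := c_ge; have := t_ge1; nra. Qed.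
Let ct_gt0 : 0 < c * t%:R. Proof. by rewrite mulr_gt0 // ltr0n. Qed.
Let pE : p * (c * t%:R) = 1 / 256.
Proof. by rewrite /p; field; rewrite !gt_eqF // ltr0n. Qed.
Let p_gt0 : 0 < p. Proof. by rewrite invr_gt0 -mulrA mulr_gt0. Qed.
Let p_le1 : p <= 1. Proof. by have := ct_ge; have := pE; have := p_gt0; nra. Qed.

(** The depth satisfies [t + m + 1 <= 2t(m + 1)], and the factorial from clique counting absorbs the
    power of [m + 1] at the cost of [4 ^ (m + 1)]. *)
Lemma sampled_shallow_subsets m W : W \subset vert H ->
  #|shallow_subsets H m.+2 (t + m.+1) W|%:R * p ^+ m.+2
    <= p * #|W|%:R * (1 / 4) ^+ m.+1.
Proof.
move=> WV; have := card_shallow_subsets hldH m.+1 (k := t + m.+1) _ WV.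
rewrite addnS => /(_ erefl); set F := #|_|%:R => F_le.
have f_gt0 : 0 < (m.+1)`!%:R :> R by rewrite ltr0n fact_gt0.
have F_le64 : F <= #|W|%:R * (64 * (c * t%:R)) ^+ m.+1.
  rewrite -(ler_pM2r f_gt0); apply: le_trans F_le _.
  rewrite -[leRHS]mulrA ler_wpM2l ?ler0n //.
  apply: (@le_trans _ _ ((16 * (c * t%:R) * m.+1%:R) ^+ m.+1)).
    have m_ge1 : 1 <= m.+1%:R :> R by rewrite ler1n.
    have sumE : (t + m).+1%:R = t%:R + m.+1%:R :> R by rewrite -addnS natrD.
    have c_ge0 : 0 <= c by apply: ltW.
    apply: lerXn2r; rewrite ?nnegrE ?mulr_ge0 ?ler0n //.
    have : t%:R + m.+1%:R <= 2 * (t%:R * m.+1%:R) :> R by have := t_ge1; nra.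
    by rewrite sumE; have := c_gt0; nra.
  have := leq_expnn_fact m.+1; rewrite -(ler_nat R) natrM !natrX.
  have -> : 64 * (c * t%:R) = 16 * (c * t%:R) * 4 by ring.
  have : 0 <= 16 * (c * t%:R) by rewrite mulr_ge0 // ltW.
  move: (16 * _) => a a_ge0 le_fact; rewrite !exprMn -[leRHS]mulrA.
  by apply: ler_wpM2l; first exact: exprn_ge0.
rewrite [_ ^+ m.+2]exprS mulrCA -mulrA; apply: ler_wpM2l; first exact: ltW.
apply: (le_trans (ler_wpM2r (exprn_ge0 _ (ltW p_gt0)) F_le64)).
rewrite -mulrA -exprMn; have -> : 64 * (c * t%:R) * p = 1 / 4 by have := pE; lra.
by [].
Qed.

(** Deletion method: in expectation, the sampled points of [W] outnumber the sampled bad sets by at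
    least [p|W|/2], and one point is dropped per bad set. *)
Lemma exists_sparse_set W : W \subset vert H ->
  exists I, [/\ I \subset W, #|W|%:R <= 512 * (c * t%:R) * #|I|%:R &
    forall h, h \in edges H -> (t < #|h :&: W|)%N ->
      (t <= #|(h :&: W) :\: I|)%N].
Proof.
move=> WV.
pose F m := shallow_subsets H m.+2 (t + m.+1) W.
pose f (S : {set T}) : R := #|S :&: W|%:R -
  \sum_(m < #|T|) #|[set b in F m | b \subset S]|%:R.
have [S fS] := expectation_attained (ltW p_gt0) p_le1 f.
have {}fS : p * #|W|%:R / 2 <= f S.
  apply: le_trans fS; rewrite /f; under eq_bigr do rewrite mulrBr mulr_sumr.
  rewrite sumrB expected_card exchange_big /=.
  under [X in _ <= _ - X]eq_bigr do rewrite expected_count.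
  suff : \sum_(m < #|T|) \sum_(b in F m) p ^+ #|b| <= p * #|W|%:R / 2 by lra.
  apply: (@le_trans _ _ (\sum_(m < #|T|) p * #|W|%:R * (1 / 4) ^+ m.+1)).
    apply: ler_sum => m _; apply: le_trans (sampled_shallow_subsets m WV).
    rewrite mulr_natl -sumr_const; apply: ler_sum => b /shallow_subsetsP[_ -> _].
    by [].
  rewrite -mulr_sumr ler_wpM2l ?mulr_ge0 ?ler0n ?(ltW p_gt0) //.
  by have := sum_quarter_powers R #|T|; lra.
pose B := \bigcup_(m < #|T|) [set b in F m | b \subset S].
(* [X] holds one chosen point of each bad set; the choice is an option, hence the detour through
   [Some]. *)
pose X := [set x | Some x \in [set [pick y in b] | b : {set T} in B]].
have XB : (#|X| <= #|B|)%N.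
  have some_inj : injective (@Some T) by move=> x y [].
  rewrite -(card_imset (mem X) some_inj).
  apply: leq_trans (leq_imset_card (fun b : {set T} => [pick y in b]) (mem B)).
  by apply/subset_leq_card/subsetP => _ /imsetP[x + ->]; rewrite inE.
exists ((S :&: W) :\: X); split.
- by apply: subset_trans (subsetDl _ _) (subsetIr _ _).
- set I := _ :\: X.
  have : #|S :&: W|%:R <= #|I|%:R + #|B|%:R :> R.
    rewrite -natrD ler_nat -(cardsID X (S :&: W)) addnC leq_add2l.
    by apply: leq_trans XB; apply/subset_leq_card/subsetIr.
  have : #|B|%:R <= \sum_(m < #|T|) #|[set b in F m | b \subset S]|%:R :> R.
    by rewrite -natr_sum ler_nat leq_card_bigcup.
  move: fS; rewrite /f => fS B_le S_le.
  have I_ge : p * #|W|%:R / 2 <= #|I|%:R by lra.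
  have -> : #|W|%:R = 256 * (p * (c * t%:R)) * #|W|%:R by rewrite pE; field.
  by have := ler_wpM2l (ltW ct_gt0) I_ge; lra.
move=> h hH; set I := _ :\: X => lt_t; rewrite leqNgt; apply/negP => few.
have [m hm] : exists m, #|h :&: W| = (t + m.+1)%N by exists (#|h :&: W| - t.+1)%N; rewrite addnS -addSn subnKC.
(* With [t + m + 1] points in the trace and fewer than [t] outside [I], at least [m + 2] lie in [I]
   and contain a bad set. *)
have [b] : exists b, b \in tsubsets ((h :&: W) :&: I) m.+2.
  by apply: exists_tsubset; have := cardsID I (h :&: W); clear -few hm; lia.
rewrite inE subsetI subsetI => /andP[/andP[/andP[bh bW] bI] /eqP bm].
have mT : (m < #|T|)%N by apply: leq_trans (max_card (h :&: W)); rewrite hm addnS ltnS leq_addl.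
have bB : b \in B.
  apply/bigcupP; exists (Ordinal mT) => //; rewrite inE; apply/andP; split.
    by apply/shallow_subsetsP; split=> //; exists h => //; rewrite hm.
  by apply: subset_trans bI (subset_trans (subsetDl _ _) (subsetIl _ _)).
case E : [pick y in b] => [x|]; last first.
  have [y yb] : exists y, y \in b by apply/card_gt0P; rewrite bm.
  by case: pickP E => // /(_ y); rewrite yb.
have xb : x \in b by case: pickP E => // y yb [<-].
have /setDP[_ /negP[]] := subsetP bI _ xb.
by rewrite inE -E; apply/imsetP; exists b.
Qed.

(* A [t]-subset is coloured by the first round whose removed set it meets. In the
   last round where [h] still has more than [t] vertices, exactly [t] of them
   survive, and they form the only [t]-subset of [h] left for later rounds. *)
Lemma colourable_induced k W : W \subset vert H ->
  #|W|%:R * (1 - (512 * (c * t%:R))^-1) ^+ k < 1 ->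
  subset_CF_colourable (induced H W) t k.
Proof.
(* [q] is the fraction of [W] that one round is sure to remove. *)
set q := _^-1.
have qE : q * (512 * (c * t%:R)) = 1.
  by rewrite mulVf // gt_eqF // mulr_gt0.
have q_gt0 : 0 < q by rewrite invr_gt0 mulr_gt0.
elim: k W => [|k IH] W WV.
  rewrite expr0 mulr1 (ltr_nat _ _ 1) ltnS leqn0 cards_eq0 => /eqP ->.
  exists (fun=> 0%N); split=> [s|_ /imsetP[h _ ->]]; last by rewrite setI0 cards0.
  by rewrite inE subset0 => /andP[/eqP->]; rewrite cards0 eq_sym gtn_eqF.
move=> Wk; have [I [IW WI hI]] := exists_sparse_set WV.
have [||phi [phi_lt phi_CF]] := IH (W :\: I).
- by apply: subset_trans (subsetDl _ _) WV.
- have q_le1 : q <= 1 by have := ct_ge; nra.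
  apply: le_lt_trans Wk; rewrite exprS mulrA ler_wpM2r ?exprn_ge0 ?subr_ge0 //.
  have : #|W|%:R = #|I|%:R + #|W :\: I|%:R :> R.
    by rewrite -natrD -(cardsID I W) (setIidPr IW).
  have : q * #|W|%:R <= #|I|%:R.
    by have := ler_wpM2l (ltW q_gt0) WI; rewrite [leRHS]mulrA qE mul1r.
  by lra.
exists (fun s => if [disjoint s & I] then (phi s).+1 else 0%N); split.
  move=> s; rewrite inE => /andP[sW st]; case: ifP => // sI.
  by apply: phi_lt; rewrite inE subsetD sW sI.
move=> _ /imsetP[h hH ->] th.
have hW'E : h :&: (W :\: I) = (h :&: W) :\: I by rewrite setIDA.
have [th'|] := ltnP t #|h :&: (W :\: I)|.
  have [|s] := phi_CF (h :&: (W :\: I)) _ th'; first by apply/imsetP; exists h.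
  rewrite hW'E inE subsetD => /andP[/andP[sh sI] st] s_uniq.
  exists s; first by rewrite inE sh.
  move=> s' /setD1P[ss']; rewrite inE => /andP[s'h s't].
  rewrite sI; case: ifP => // s'I [] eq_phi.
  by apply: (s_uniq s') => //; rewrite !inE ss' subsetD s'h s'I.
rewrite hW'E => h't; have {}h't : #|(h :&: W) :\: I| = t.
  by apply/eqP; rewrite eqn_leq h't hI.
exists ((h :&: W) :\: I); first by rewrite inE subsetDl h't eqxx.
move=> s' /setD1P[ss']; rewrite inE => /andP[s'h /eqP s't].
have h'I : [disjoint (h :&: W) :\: I & I] by rewrite -setI_eq0 setIDAC -setIDA setDv setI0.
rewrite h'I; case: ifP => // s'I; case/eqP: ss'.
by apply/eqP; rewrite eqEcard subsetD s'h s'I h't s't leqnn.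
Qed.

End UpperBound.

(** * The logarithmic upper bound *)

Section Chi.
Variables (T : finType) (H : hypergraph T) (t : nat).

Lemma chi_CF_le k : subset_CF_colourable H t k -> (chi_CF t H <= k)%N.
Proof. by move=> Hk; rewrite /chi_CF; case: ex_minnP => m _; apply; apply/asboolP. Qed.

Lemma chi_CF_colourable : subset_CF_colourable H t (chi_CF t H).
Proof. by rewrite /chi_CF; case: ex_minnP => m /asboolP. Qed.

(** For [t = 0] the empty set is the only [t]-subset; otherwise no hyperedge is large enough to
    impose a condition. *)
Lemma chi_CF_le1 :
  (forall h, h \in edges H -> (t < #|h|)%N -> t = 0%N) -> (chi_CF t H <= 1)%N.
Proof.
move=> t0; apply: chi_CF_le; exists (fun=> 0%N); split=> // h hH th.
have {}t0 := t0 h hH th; rewrite {}t0; exists set0; first by rewrite inE sub0set cards0.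
by move=> s /setD1P[s0]; rewrite inE cards_eq0 (negbTE s0) andbF.
Qed.

Lemma induced_vert k :
  subset_CF_colourable (induced H (vert H)) t k -> subset_CF_colourable H t k.
Proof.
case=> phi [phi_lt phi_CF]; exists phi; split=> // h hH th; apply: phi_CF => //.
apply/imsetP; exists h => //; apply/esym/setIidPl.
by rewrite -powersetE; apply: subsetP (edges_vert H) h hH.
Qed.

End Chi.

Lemma chi_CF_upper (R : realType) t (c : R) (T : finType) (H : hypergraph T) :
  0 < c -> HLD c H ->
  (chi_CF t H)%:R
    <= Num.max 1 (516 * (c * t%:R ^+ 2 * ln (#|vert H|%:R : R))).
Proof.
move=> c_gt0 hldH; rewrite le_max.
have [t_eq0|t_gt0] := posnP t.
  by rewrite (ler_nat _ _ 1) chi_CF_le1.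
have [/existsP[h /andP[hH th]]|/existsPn no_h] :=
    boolP [exists h, (h \in edges H) && (t < #|h|)%N]; last first.
  rewrite (ler_nat _ _ 1) chi_CF_le1 // => h hH th.
  by have := no_h h; rewrite hH th.
apply/orP; right.
have hV : h \subset vert H by rewrite -powersetE (subsetP (edges_vert H)).
have h2 : (2 <= #|h|)%N by apply: leq_trans th.
(* A pair [e] inside [h] is a Delaunay edge of the hypergraph induced on [e], so [1 <= 2c]. *)
have c_ge : 1 / 2 <= c.
  have [e] := exists_tsubset h2; rewrite inE => /andP[eh /eqP e2].
  have := HLD_card hldH (subset_trans eh hV); rewrite e2.
  suff : 1 <= #|[set b in [set h0 :&: e | h0 in edges H] | #|b| == 2]|%:R :> R by lra.
  rewrite (ler_nat _ 1) card_gt0; apply/set0Pn; exists e; rewrite inE e2 eqxx andbT.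
  by apply/imsetP; exists h => //; apply/esym/setIidPr.
have V2 : (2 <= #|vert H|)%N by apply: leq_trans (subset_leq_card hV).
set n : R := #|vert H|%:R.
have n2 : 2 <= n by rewrite (ler_nat _ 2).
have ln_ge : 1 / 2 <= ln n.
  have ln2 : 1 / 2 <= ln (2 : R).
    have := @le_ln1Dx R (- (1 / 2)) ; have -> : 1 + - (1 / 2) = 2^-1 :> R by field.
    by rewrite lnV ?posrE //; lra.
  by apply: le_trans ln2 _; rewrite ler_ln ?posrE; lra.
have t_ge1 : 1 <= t%:R :> R by rewrite (ler_nat _ 1).
have ct_ge : 1 / 2 <= c * t%:R by nra.
pose q := (512 * (c * t%:R))^-1.
have q_gt0 : 0 < q by rewrite invr_gt0; lra.
have qE : q * (512 * (c * t%:R)) = 1 by rewrite mulVf // gt_eqF //; lra.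
have x_ge0 : 0 <= ln n / q by rewrite divr_ge0; lra.
(* Since [1 - q <= exp(-q)], more than [ln n / q] rounds bring [n] vertices below 1. *)
have /andP[k_le k_gt] := truncn_itv x_ge0.
set k := Num.trunc _ in k_le k_gt.
have : subset_CF_colourable H t k.+1.
  apply/induced_vert/(colourable_induced hldH c_ge t_gt0) => //.
  rewrite -/q -/n; have n_gt0 : 0 < n by lra.
  apply: (@le_lt_trans _ _ (n * expR (- q) ^+ k.+1)).
    rewrite ler_pM2l //; apply: lerXn2r; rewrite ?nnegrE ?expR_ge0 //.
      by have := ct_ge; nra.
    exact: expR_ge1Dx.
  rewrite -expRM_natl -[X in X * _](@lnK R) ?posrE // -expRD -[ltRHS]expR0 ltr_expR.
  by move: k_gt; rewrite ltr_pdivrMr //; lra.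
move/chi_CF_le; rewrite -(ler_nat R) => /le_trans; apply.
rewrite -natr1.
(* The extra round costs 1, which is at most [4 * (c * t * ln n)] because [c * t] and [ln n] are at
   least 1/2; hence 516 rather than 512. *)
have : k%:R <= 512 * (c * t%:R) * ln n.
  apply: le_trans k_le _; rewrite /q invrK; lra.
have : c * t%:R <= c * t%:R ^+ 2 by rewrite expr2; nra.
by nra.
Qed.

(** * Intervals of a path and the lower bound *)

Section Intervals.
Variable n : nat.
Implicit Types (x y z : 'I_n) (a b : nat).

Definition convex (h : {set 'I_n}) : bool :=
  [forall x in h, forall z in h, forall y : 'I_n, (x <= y <= z)%N ==> (y \in h)].

Lemma convexP {h : {set 'I_n}} :
  reflect (forall x y z, x \in h -> z \in h -> (x <= y <= z)%N -> y \in h)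
          (convex h).
Proof.
apply: (iffP forall_inP) => [cvx x y z xh zh xyz|cvx x xh].
  by have /forall_inP/(_ z zh)/forallP/(_ y)/implyP := cvx x xh; apply.
by apply/forall_inP => z zh; apply/forallP => y; apply/implyP; apply: cvx.
Qed.

Lemma interval_hypergraph_subproof :
  [set h : {set 'I_n} | convex h] \subset powerset [set: 'I_n].
Proof. by apply/subsetP => h _; rewrite powersetE subsetT. Qed.

Definition interval_hypergraph := Hypergraph interval_hypergraph_subproof.

Lemma interval_HLD (R : realType) : HLD (1 : R) interval_hypergraph.
Proof.
move=> W _; rewrite mul1r ler_nat.
(* A Delaunay edge joins a point of W to its successor in W. *)
pose next x := [set y in W | (x < y)%N & [forall z in W, (x < z)%N ==> (y <= z)%N]].
apply: leq_trans (leq_imset_card (fun x => x |: next x) (mem W)).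
apply/subset_leq_card/subsetP => e.
rewrite inE => /andP[/imsetP[h]]; rewrite inE => /convexP cvx eE /cards2P[x [y [xy exy]]].
wlog lt_xy : x y xy exy / (x < y)%N.
  move=> IH; case: (ltngtP x y) => [|yx|/val_inj e0]; first exact: IH.
    by apply: IH yx; rewrite 1?eq_sym // setUC.
  by rewrite e0 eqxx in xy.
have xe : x \in e by rewrite exy !inE eqxx.
have ye : y \in e by rewrite exy !inE eqxx orbT.
have between z : z \in W -> (x <= z <= y)%N -> z \in e.
  move: xe ye; rewrite eE => /setIP[xh _] /setIP[yh _] zW xzy.
  by rewrite inE zW andbT; apply: cvx xzy.
have /andP[xW yW] : (x \in W) && (y \in W).
  by move: xe ye; rewrite eE => /setIP[_ ->] /setIP[_ ->].
apply/imsetP; exists x => //; rewrite exy; congr (_ |: _).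
apply/setP => z; rewrite !inE; apply/eqP/and3P => [->|[zW xz /forall_inP zmin]].
  split=> //; apply/forall_inP => z' z'W; apply/implyP => xz'; rewrite leqNgt.
  apply/negP => z'y; have := between z' z'W; rewrite (ltnW xz') (ltnW z'y) => /(_ erefl).
  by rewrite exy !inE => /orP[] /eqP zE; rewrite zE ltnn in xz' z'y.
have zy : (z <= y)%N by have := zmin y yW; rewrite lt_xy.
have := between z zW; rewrite (ltnW xz) zy => /(_ erefl).
by rewrite exy !inE => /orP[] /eqP // zE; rewrite zE ltnn in xz.
Qed.

Definition interval a b : {set 'I_n} := [set x : 'I_n | (a <= x < b)%N].

Lemma interval_convex a b : convex (interval a b).
Proof. by apply/convexP => x y z; rewrite !inE; lia. Qed.

Lemma card_interval a b : (b <= n)%N -> #|interval a b| = (b - a)%N.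
Proof.
move=> bn; rewrite -sum1_card (eq_bigl (fun x : 'I_n => (a <= x < b)%N)); last first.
  by move=> x; rewrite inE.
rewrite -(big_mkord (fun i => a <= i < b)%N (fun=> 1%N)).
rewrite -(@big_nat_widen _ _ _ 0 b n (fun i => a <= i)%N) //.
rewrite -(@big_nat_widenl _ _ _ a 0 b xpredT) //.
by rewrite sum_nat_const_nat muln1.
Qed.

(* Deleting a vertex of the uniquely coloured [t]-subset of an interval leaves
   two intervals, neither of which uses its colour. *)
Lemma interval_length_bound t phi k (K : seq nat) a b :
  (0 < t)%N -> subset_CF_colouring interval_hypergraph t k phi ->
  (b <= n)%N -> (forall s, s \in tsubsets (interval a b) t -> phi s \in K) ->
  (b - a < 2 ^ size K * t.+1)%N.
Proof.
move=> t_gt0 [_ phi_CF]; have [j] := ubnP (size K).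
elim: j K a b => // j IH K a b /ltnSE Kj bn phiK.
have pow_gt0 i : (0 < 2 ^ i)%N by rewrite expn_gt0.
have [le_t|lt_t] := leqP (b - a) t; first by have := pow_gt0 (size K); nia.
have [||s sh s_uniq] := phi_CF (interval a b).
- by rewrite inE interval_convex.
- by rewrite card_interval.
have sK := phiK s sh.
have [sab /eqP st] : s \subset interval a b /\ #|s| == t by move: sh; rewrite inE => /andP.
have [x xs] : exists x, x \in s by apply/card_gt0P; rewrite st.
have := subsetP sab x xs; rewrite inE => /andP[ax xb].
pose K' := [seq y <- K | y != phi s].
have K'K : (size K' < size K)%N.
  rewrite size_filter -(count_predC (pred1 (phi s)) K) -addn1 addnC.
  by rewrite leq_add2r -has_count has_pred1.
have half a' b' : (a <= a')%N -> (b' <= b)%N -> ~~ (a' <= x < b')%N ->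
    (b' - a' < 2 ^ size K' * t.+1)%N.
  move=> aa' bb' xab'; apply: IH; [exact: leq_trans Kj | exact: leq_trans bn |] => s'.
  rewrite inE => /andP[s'ab' s't].
  have s'ab : s' \in tsubsets (interval a b) t.
    rewrite inE s't andbT; apply: subset_trans s'ab' _.
    apply/subsetP => y; rewrite !inE => /andP[ay yb].
    by rewrite (leq_trans aa' ay) (leq_trans yb bb').
  rewrite mem_filter phiK // andbT eq_sym; apply/eqP; apply: s_uniq.
  rewrite in_setD1 s'ab andbT; apply: contraNneq xab' => s's.
  by have := subsetP s'ab' x; rewrite s's xs inE => ->.
have left_half : (x - a < 2 ^ size K' * t.+1)%N by apply: half; lia.
have right_half : (b - x.+1 < 2 ^ size K' * t.+1)%N by apply: half; lia.
(* The deleted vertex [x] adds 1 to the two lengths, which the two strict inequalities absorb. *)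
have : (2 ^ (size K').+1 * t.+1 <= 2 ^ size K * t.+1)%N by rewrite leq_mul2r leq_exp2l.
by rewrite expnS; lia.
Qed.

Lemma chi_CF_interval t : (0 < t)%N ->
  (n < 2 ^ chi_CF t interval_hypergraph * t.+1)%N.
Proof.
move=> t_gt0; have [phi phi_col] := chi_CF_colourable interval_hypergraph t.
have := @interval_length_bound t phi _ (iota 0 (chi_CF t interval_hypergraph)) 0 n
  t_gt0 phi_col (leqnn n).
rewrite subn0 size_iota; apply=> s; rewrite inE => /andP[_ st].
by rewrite mem_iota add0n; apply: phi_col.1; rewrite inE subsetT st.
Qed.

End Intervals.

(** As [t + 1 <= M], one factor [M] cancels from [M ^ 2 < 2 ^ k * (t + 1)], leaving [M <= 2 ^ k].
    The square makes the constant 1/2 independent of [t]. *)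
Lemma chi_CF_interval_log (R : realType) t M : (0 < t)%N -> (t < M)%N ->
  1 / 2 * ln ((M ^ 2)%:R : R) <= (chi_CF t (interval_hypergraph (M ^ 2)))%:R.
Proof.
move=> t_gt0 tM; set k := chi_CF _ _.
have M_le : (M <= 2 ^ k)%N.
  have := chi_CF_interval (M ^ 2) t_gt0; rewrite -/k => lt_M.
  have : (M * M < 2 ^ k * M)%N by apply: leq_trans lt_M _; rewrite leq_mul2l tM orbT.
  by rewrite ltn_mul2r => /andP[_ /ltnW].
have M_gt0 : (0 < M)%N by lia.
rewrite natrX lnXn ?ltr0n // -mulr_natr.
have : ln (M%:R : R) <= ln ((2 ^ k)%:R : R) by rewrite ler_ln ?posrE ?ltr0n ?expn_gt0 ?ler_nat.
rewrite natrX lnXn // -mulr_natr => lnM.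
have ln2 : ln (2 : R) <= 1 by have := @le_ln1Dx R 1; rewrite -natr1; apply; lra.
have : 0 <= k%:R :> R by []; nra.
Qed.

Unset Implicit Arguments.

(* The maximum with 1 in the upper bound is needed only in degenerate cases
   (t = 0, #|V| <= 1, or arbitrarily small c), where one colour suffices but
   c t^2 log #|V| can be smaller than any positive constant.  If some hyperedge
   has more than t >= 1 vertices then #|V| >= 2 and c >= 1/2, so, enlarging C,
   the bound reads chi_CF t H <= C c t^2 log #|V|. *)
Theorem theorem1p4 (R : realType) :
  (exists C : R, 0 < C /\
     forall (t : nat) (c : R) (T : finType) (H : hypergraph T),
       0 < c -> HLD c H ->
       (chi_CF t H)%:R
         <= Num.max 1 (C * (c * t%:R ^+ 2 * ln (#|vert H|%:R : R)))) /\
  (exists c delta : R, [/\ 0 < c, 0 < delta &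
     forall t N : nat, (0 < t)%N ->
       exists (T : finType) (H : hypergraph T),
         [/\ (N <= #|vert H|)%N, HLD c H &
             delta * ln (#|vert H|%:R : R) <= (chi_CF t H)%:R]]).
Proof.
split.
  exists 516; split; first by lra.
  by move=> t c T H; apply: chi_CF_upper.
exists 1, (1 / 2); split; [lra | lra |] => t N t_gt0.
exists 'I_((t + N).+1 ^ 2)%N, (interval_hypergraph ((t + N).+1 ^ 2)).
rewrite cardsT card_ord; split.
- by nia.
- exact: interval_HLD.
- by apply: chi_CF_interval_log; lia.
Qed.
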